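(* Let $a>1$, $\lambda>0$. The quadratic program $$\min_{\beta,g,h\in\mathbb R^d}\ \tfrac12\big(\beta^\top Q\beta+n(a-1)g^\top g+2ng^\top h\big)+q^\top\beta-na\lambda\mathbf 1^\top g$$ $$\text{s.t.}\quad\beta\in\Lambda;\quad h\ge\beta;\quad h\ge-\beta;\quad0\le g\le\lambda$$ is equivalent to the linear program with (linear) complementarity constraints $$\min\ \tfrac12q^\top\beta-\tfrac12\mathbf b^\top\rho-\tfrac12na\lambda\mathbf 1^\top g-\tfrac12\lambda\gamma_4^\top\mathbf 1$$ $$\text{s.t.}\quad\begin{cases}Q\beta+q+\gamma_1-\gamma_2+\mathcal A\rho=0;\quad ng-\gamma_1-\gamma_2=0,\\ n(a-1)g+nh-na\lambda\mathbf 1-\gamma_3+\gamma_4=0,\\ 0\le\gamma_1\perp h-\beta\ge0;\quad0\le\gamma_2\perp h+\beta\ge0,\\ 0\le\gamma_3\perp g\ge0;\quad0\le\gamma_4\perp\lambda\mathbf 1-g\ge0,\\ 0\le\rho\perp\mathbf b-\mathcal A^\top\beta\ge0,\\ \beta,g,h,\gamma_1,\gamma_2,\gamma_3,\gamma_4\in\mathbb R^d;\quad\rho\in\mathbb R^m,\end{cases}$$ i.e. $(\beta,g,h)$ is a global minimizer of the quadratic program if and only if there exist $\gamma_1,\gamma_2,\gamma_3,\gamma_4\in\mathbb R^d$ and $\rho\in\mathbb R^m$ such that $(\beta,g,h,\gamma_1,\gamma_2,\gamma_3,\gamma_4,\rho)$ is a global minimizer of the complementarity program.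
   Context: Setting: $n\ge1$ is the sample size, $d\ge1$ the dimension, $0\le m<d$; $Q\in\mathbb R^{d\times d}$ is symmetric (not necessarily positive semidefinite), $q\in\mathbb R^d$, $\mathcal A\in\mathbb R^{d\times m}$ has full rank, $\mathbf b\in\mathbb R^m$, and $\Lambda:=\{\beta\in\mathbb R^d:\mathcal A^\top\beta\le\mathbf b\}$ is nonempty. $\mathbf 1$ is the all-ones vector; vector inequalities are componentwise. For vectors $\Phi=(\phi_i)$, $\Delta=(\delta_i)$ of the same dimension, $0\le\Phi\perp\Delta\ge0$ means $\phi_i\ge0$, $\delta_i\ge0$ and $\phi_i\delta_i=0$ for all $i$. Standing assumption: the SCAD penalized problem $\min_{\beta\in\Lambda}\tfrac12\beta^\top Q\beta+q^\top\beta+n\sum_{i=1}^dP_{\mathrm{SCAD},\lambda}(|\beta_i|)$ has a finite global solution, where $P_{\mathrm{SCAD},\lambda}(\theta)=\int_0^\theta\lambda\{\mathbb I(t\le\lambda)+\frac{(a\lambda-t)_+}{(a-1)\lambda}\mathbb I(t>\lambda)\}\,dt$ for $\theta\ge0$ and $(b)_+=\max\{b,0\}$. *)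

(* Defs.v *)
From HB Require Import structures.
From mathcomp Require Import all_boot all_order all_algebra.
From mathcomp Require Import all_classical all_reals.
From mathcomp Require Import measure lebesgue_measure lebesgue_integral.

Set Implicit Arguments.
Unset Strict Implicit.
Unset Printing Implicit Defensive.

Import Order.TTheory GRing.Theory Num.Theory.
Local Open Scope classical_set_scope.
Local Open Scope ring_scope.

Definition is_global_min (R : realType) (T : Type) (S : set T) (f : T -> R)
    (x : T) : Prop :=
  S x /\ forall y, S y -> f x <= f y.

Section Vectors.
Variables (R : realType) (k : nat).
Implicit Types u v : 'cV[R]_k.

Definition dotv u v : R := (u^T *m v) 0 0.

Definition lev u v : Prop := forall i, u i 0 <= v i 0.

Definition ones : 'cV[R]_k := const_mx 1.

(* 0 <= u _|_ v >= 0 *)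
Definition complementary u v : Prop :=
  forall i, [/\ 0 <= u i 0, 0 <= v i 0 & u i 0 * v i 0 = 0].

End Vectors.

Arguments ones {R k}.

Section Problems.
Variables (R : realType) (n d m : nat) (a lambda : R).
Variables (Q : 'M[R]_d) (q : 'cV[R]_d) (A : 'M[R]_(d, m)) (b : 'cV[R]_m).

Definition polyhedron : set 'cV[R]_d := [set beta | lev (A^T *m beta) b].

(* Indicators are booleans cast to R by %:R. Only used for theta >= 0, where
   the Lebesgue integral over [0, theta] is the oriented one. *)
Definition P_SCAD (theta : R) : R :=
  (\int[@lebesgue_measure R]_(t in `[0, theta])
    (lambda * ((t <= lambda)%R%:R +
       Num.max (a * lambda - t) 0 / ((a - 1) * lambda)
         * (lambda < t)%R%:R)))%R.

Definition scad_obj (beta : 'cV[R]_d) : R :=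
  2^-1 * dotv beta (Q *m beta) + dotv q beta
  + n%:R * \sum_(i < d) P_SCAD `|beta i 0|.

Record qp_point : Type := QPPoint {
  qp_beta : 'cV[R]_d; qp_g : 'cV[R]_d; qp_h : 'cV[R]_d }.

Definition qp_obj (x : qp_point) : R :=
  let: QPPoint beta g h := x in
  2^-1 * (dotv beta (Q *m beta) + n%:R * (a - 1) * dotv g g
          + 2 * n%:R * dotv g h)
  + dotv q beta - n%:R * a * lambda * dotv ones g.

Definition qp_feasible : set qp_point := fun x =>
  let: QPPoint beta g h := x in
  [/\ polyhedron beta, lev beta h, lev (- beta) h,
      lev 0 g & lev g (lambda *: ones)].

Record lpcc_point : Type := LPCCPoint {
  lpcc_beta : 'cV[R]_d; lpcc_g : 'cV[R]_d; lpcc_h : 'cV[R]_d;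
  lpcc_gamma1 : 'cV[R]_d; lpcc_gamma2 : 'cV[R]_d;
  lpcc_gamma3 : 'cV[R]_d; lpcc_gamma4 : 'cV[R]_d;
  lpcc_rho : 'cV[R]_m }.

Definition lpcc_obj (x : lpcc_point) : R :=
  let: LPCCPoint beta g h gamma1 gamma2 gamma3 gamma4 rho := x in
  2^-1 * dotv q beta - 2^-1 * dotv b rho
  - 2^-1 * (n%:R * a * lambda) * dotv ones g
  - 2^-1 * lambda * dotv gamma4 ones.

Definition lpcc_feasible : set lpcc_point := fun x =>
  let: LPCCPoint beta g h gamma1 gamma2 gamma3 gamma4 rho := x in
  [/\ Q *m beta + q + gamma1 - gamma2 + A *m rho = 0,
      n%:R *: g - gamma1 - gamma2 = 0 &
      (n%:R * (a - 1)) *: g + n%:R *: h - (n%:R * a * lambda) *: ones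
        - gamma3 + gamma4 = 0] /\
  [/\ complementary gamma1 (h - beta),
      complementary gamma2 (h + beta),
      complementary gamma3 g,
      complementary gamma4 (lambda *: ones - g) &
      complementary rho (b - A^T *m beta)].

End Problems.

(* Main.v *)
Require Import Defs.
From HB Require Import structures.
From mathcomp Require Import all_boot all_order all_algebra.
From mathcomp Require Import all_classical all_reals.
From mathcomp Require Import measure lebesgue_measure lebesgue_integral.
From mathcomp Require Import topology normedtype derive realfun ftc.
From mathcomp Require Import ring lra.

(** The complementarity system is the KKT system of the quadratic program:
    [gamma1], [gamma2] are the multipliers of [h >= beta], [h >= - beta],
    [gamma3], [gamma4] those of [0 <= g <= lambda], and [rho] that of the
    polyhedron. Two facts make the programs equivalent.

    - All constraints are affine, so every global minimizer of the quadratic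
      program is a KKT point without any constraint qualification
      ([qp_min_kkt]). This is Farkas' lemma ([farkas]) applied to the first
      order condition on the cone of feasible directions
      ([linear_constraints_kkt]).
    - At a KKT point the quadratic objective equals the linear objective: pair
      the stationarity equations with [beta], [h] and [g], and use
      complementarity ([lpcc_obj_qp]).

    So the complementarity program minimizes the quadratic objective over the
    KKT points only. A minimizer of the quadratic program is a KKT point,
    hence it minimizes the objective among them. Conversely, a best KKT point
    is a global minimizer as soon as the quadratic program has some global
    minimizer, since that minimizer is itself a KKT point; without attainment
    a best KKT point could be a mere stationary point of an unbounded program.

    Attainment comes from the SCAD problem. The penalty is, up to an additive
    constant, a minimum of quadratic functions with linear terms in
    [t = |beta i|]:
      P(t) = const + min over 0 <= g <= lambda of
               (a - 1) / 2 * g ^ 2 + g * t - a * lambda * g,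
    attained at [g = P'(t)] ([scad_dual_ge], [scad_dual_slope]). Minimizing
    the quadratic program over [g], and over [h >= |beta|], which is best at
    [h = |beta|] because [g >= 0], therefore gives back the SCAD problem, and
    a SCAD minimizer lifts to a minimizer of the quadratic program
    ([qp_min_of_scad_min]). *)

Set Implicit Arguments.
Unset Strict Implicit.
Unset Printing Implicit Defensive.

Import Order.TTheory GRing.Theory Num.Theory.
Import numFieldNormedType.Exports.
Local Open Scope classical_set_scope.
Local Open Scope ring_scope.

(** * Farkas' lemma and first order conditions under affine constraints *)

Section Farkas.
Variables (R : realFieldType) (V : lmodType R) (I : finType).

(** Bartl's induction on the number of inequalities. If the last inequality
    [a j <= 0] matters, there is [x1] satisfying the others with
    [0 < c x1], and then [0 < a j x1]. Projecting along [x1] onto the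
    hyperplane [a j = 0] turns the problem into one with fewer inequalities;
    the coefficient of [a j] that undoes the projection is nonnegative by the
    choice of [x1]. No finite dimension is involved, which lets the lemma be
    used on products of spaces of columns directly. *)
Lemma farkas (s : seq I) (a : I -> V -> R) (c : V -> R) :
    (forall i, scalar (a i)) -> scalar c ->
    (forall x, (forall i, i \in s -> a i x <= 0) -> c x <= 0) ->
  exists y : I -> R, [/\ forall i, 0 <= y i, forall i, i \notin s -> y i = 0
    & forall x, c x = \sum_i y i * a i x].
Proof.
elim: s a c => [|j s IH] a c la lc hc.
  exists (fun=> 0); split=> // x.
  rewrite big1 => [|i _]; last by rewrite mul0r.
  have c0 : c 0 = 0 by have := lc 1 0 0; rewrite scaler0 addr0; lra.
  have := hc (- x); rewrite -[- x]addr0 -scaleN1r lc c0.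
  have := hc x => H1 H2; have := H1 (fun _ _ => ltac:(done)).
  have := H2 (fun _ _ => ltac:(done)); lra.
case: (pselect (forall x, (forall i, i \in s -> a i x <= 0) -> c x <= 0)).
  move=> /(IH _ _ la lc)[y [y0 ys cy]]; exists y; split => // i.
  by rewrite inE negb_or => /andP[_ /ys].
move=> /existsNP[x1] /not_implyP[x1s /negP]; rewrite -ltNge => cx1.
have ajx1 : 0 < a j x1.
  rewrite ltNge; apply/negP => ajx1.
  have : c x1 <= 0; last by lra.
  by apply: hc => i; rewrite inE => /predU1P[->//|]; exact: x1s.
(* [r f] is [f] precomposed with the projection along [x1] onto [a j = 0]. *)
pose w (f : V -> R) := f x1 / a j x1.
pose r (f : V -> R) (x : V) : R := f x - w f * a j x.
have lr f : scalar f -> scalar (r f).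
  by move=> lf k u v; rewrite /r lf la; ring.
have rE f x : scalar f -> f ((- (a j x / a j x1)) *: x1 + x) = r f x.
  by move=> lf; rewrite lf /r /w; ring.
have [|y [y0 ys cy]] := IH (fun i => r (a i)) (r c) (fun i => lr (a i) (la i)) (lr c lc).
  move=> x rx; rewrite -rE//; apply: hc => i; rewrite inE => /predU1P[->|si].
    by rewrite rE// /r /w divff ?gt_eqF// mul1r subrr.
  by rewrite rE// rx.
pose k := w c - \sum_i y i * w (a i).
have k0 : 0 <= k.
  rewrite subr_ge0 (@le_trans _ _ 0)//; last by rewrite divr_ge0// ltW.
  apply: sumr_le0 => i _; have [si|/ys ->] := boolP (i \in s); last by rewrite mul0r.
  by rewrite mulr_ge0_le0// mulr_le0_ge0 ?x1s// invr_ge0 ltW.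
exists (fun i => y i + (i == j)%:R * k); split.
- by move=> i; rewrite addr_ge0// mulr_ge0// ler0n.
- move=> i; rewrite inE negb_or => /andP[/negbTE-> /ys->].
  by rewrite mul0r addr0.
move=> x.
have -> : c x = r c x + w c * a j x by rewrite /r; ring.
have sumr : \sum_i y i * r (a i) x
    = \sum_i y i * a i x - (\sum_i y i * w (a i)) * a j x.
  rewrite mulr_suml -sumrB; apply: eq_bigr => i _; rewrite /r; ring.
have sumj : \sum_i (y i + (i == j)%:R * k) * a i x
    = \sum_i y i * a i x + k * a j x.
  under eq_bigr do rewrite mulrDl -mulrA.
  rewrite big_split /= -[X in _ + X = _]mulr1; congr (_ + _).
  rewrite mulr1 (bigD1 j)//= eqxx mul1r big1 ?addr0// => i /negbTE->.
  by rewrite mul0r.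
rewrite cy sumr sumj /k; ring.
Qed.

End Farkas.

Section KKT.
Variables (R : realFieldType) (V : lmodType R) (I : finType).

(** Here [L] is the differential of [f] at [x]. A direction [v] along which no
    active constraint increases can be followed for a short time without
    leaving the polyhedron, so minimality forces [0 <= L v]; Farkas' lemma then
    writes [- L] as a nonnegative combination of the active constraints. *)
Lemma linear_constraints_kkt (a : I -> V -> R) (b : I -> R) (f : V -> R)
    (L B : V -> R) (x : V) :
    (forall i, scalar (a i)) -> scalar L ->
    (forall t v, f (t *: v + x) = f x + t * L v + t ^+ 2 * B v) ->
    (forall i, a i x <= b i) ->
    (forall z, (forall i, a i z <= b i) -> f x <= f z) ->
  exists y : I -> R, [/\ forall i, 0 <= y i,
    forall i, y i * (b i - a i x) = 0 & forall v, L v + \sum_i y i * a i v = 0].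
Proof.
move=> la lL fE xfeas xmin.
pose active := [seq i <- enum I | a i x == b i].
have inactive i : i \notin active -> 0 < b i - a i x.
  by rewrite mem_filter mem_enum andbT subr_gt0 lt_neqAle xfeas andbT.
have [||v vact|y [y0 ys cy]] := @farkas _ _ _ active a (fun v => - L v).
- exact: la.
- by move=> k u v; rewrite lL; ring.
- rewrite oppr_le0 leNgt; apply/negP => Lv.
  (* The step is [T^-1]: [T] exceeds each ratio that would break an inactive
     constraint, and the last summand makes the first order decrease dominate
     the second order term. *)
  pose T0 := 1 + \sum_i `|a i v / (b i - a i x)|.
  pose T := T0 + `|B v / L v|.
  have T0_gt0 : 0 < T0 by rewrite ltr_pwDl// sumr_ge0.
  have T_gt0 : 0 < T by rewrite ltr_pwDl.
  have := xmin (T^-1 *: v + x); rewrite fE.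
  have step i : a i (T^-1 *: v + x) <= b i.
    rewrite la -lerBrDr ler_pdivrMl//.
    have [iact|/inactive slack] := boolP (i \in active).
      by rewrite (le_trans (vact _ iact))// mulr_ge0 ?subr_ge0// ltW.
    rewrite -ler_pdivrMr// (le_trans (ler_norm _))// /T /T0 (bigD1 i)//=.
    have : 0 <= \sum_(i0 | i0 != i) `|a i0 v / (b i0 - a i0 x)|.
      exact: sumr_ge0.
    have := normr_ge0 (B v / L v); lra.
  move=> /(_ step); rewrite -addrA lerDl.
  have -> : T^-1 * L v + T^-1 ^+ 2 * B v = T^-1 ^+ 2 * (T * L v + B v).
    by field; rewrite gt_eqF.
  rewrite pmulr_rge0 ?exprn_gt0 ?invr_gt0// /T mulrDl.
  have -> : `|B v / L v| * L v = - `|B v|.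
    rewrite normrM normfV (ltr0_norm Lv); field; lra.
  have : T0 * L v < 0 by rewrite pmulr_rlt0.
  have := ler_norm (B v); lra.
exists y; split => // [i|v].
  have [|/ys->] := boolP (i \in active); last by rewrite mul0r.
  by rewrite mem_filter => /andP[/eqP-> _]; rewrite subrr mulr0.
by rewrite -cy subrr.
Qed.

End KKT.

(** * The SCAD penalty as a minimum of quadratic functions *)

(** The remainder at [x] of the first order expansion of [max(x, 0) ^ 2] is at
    most [h ^ 2], also across the kink at [0]. Having this derivative on the
    whole line avoids splitting the SCAD integral at its breakpoints. *)
Lemma is_derive_sqr_pos (R : realType) (x : R) :
  is_derive x 1 (fun t : R => Num.max t 0 ^+ 2) (2 * Num.max x 0).
Proof.
suff quot : (h^-1 *: (Num.max (h *: 1 + x) 0 ^+ 2 - Num.max x 0 ^+ 2)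
    @[h --> (0 : R)^']) --> 2 * Num.max x 0.
  by split; [apply/cvg_ex; exists (2 * Num.max x 0) | apply: cvg_lim].
apply/cvgrPdist_le => e e0; near=> h.
have h0 : h != 0 by near: h; exact: nbhs_dnbhs_neq.
have he : `|h| <= e by near: h; apply: dnbhs0_le.
apply: le_trans he.
suff : `|Num.max (h + x) 0 ^+ 2 - Num.max x 0 ^+ 2 - 2 * Num.max x 0 * h|
    <= h ^+ 2.
  rewrite /GRing.scale /= mulr1 [in X in X -> _]distrC.
  set u := Num.max (h + x) 0 ^+ 2 - _.
  have -> : 2 * Num.max x 0 - h^-1 * u = h^-1 * (2 * Num.max x 0 * h - u).
    by field.
  move=> uh; rewrite normrM normfV ler_pdivrMl ?normr_gt0//.
  by rewrite -expr2 real_normK ?num_real.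
rewrite ler_norml; case: (lerP x 0) => ?; case: (lerP (h + x) 0) => ?;
  apply/andP; split; nra.
Unshelve. all: by end_near. Qed.

Section ScadPenalty.
Variables (R : realType) (a lambda : R).
Hypotheses (a_gt1 : 1 < a) (lambda_gt0 : 0 < lambda).

(** The SCAD integrand is [lambda] up to [lambda], then decreases linearly to
    [0] at [a * lambda]; it is thus a difference of two positive parts, with no
    case distinction left. *)
Definition scad_slope (t : R) : R :=
  (Num.max (a * lambda - t) 0 - Num.max (lambda - t) 0) / (a - 1).

Definition scad_primitive (t : R) : R :=
  - (Num.max (a * lambda - t) 0 ^+ 2 - Num.max (lambda - t) 0 ^+ 2)
    / (2 * (a - 1)).

Lemma scad_slopeE (t : R) :
  lambda * ((t <= lambda)%R%:R + Num.max (a * lambda - t) 0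
     / ((a - 1) * lambda) * (lambda < t)%R%:R) = scad_slope t.
Proof.
have a1 : a - 1 != 0 by rewrite subr_eq0 gt_eqF.
have l0 : lambda != 0 by rewrite gt_eqF.
rewrite /scad_slope; case: (leP t lambda) => tl /=.
  rewrite !max_l ?subr_ge0//; last by apply: le_trans tl _; rewrite ler_peMl// ltW.
  by field; rewrite a1 l0.
rewrite (@max_r _ _ (lambda - t)) ?subr_le0 ?(ltW tl)//.
by field; rewrite a1 l0.
Qed.

Lemma is_derive_scad_primitive (t : R) :
  is_derive t 1 scad_primitive (scad_slope t).
Proof.
have a1 : a - 1 != 0 by rewrite subr_eq0 gt_eqF.
have sq (c : R) : is_derive t 1 (fun s : R => Num.max (c - s) 0 ^+ 2)
    (- (2 * Num.max (c - t) 0)).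
  rewrite -mulrN1.
  apply: (@is_derive1_comp R (fun s => Num.max s 0 ^+ 2) (fun s => c - s)).
    exact: is_derive_sqr_pos.
  by apply: is_derive_eq; rewrite add0r mul1r.
pose F : R -> R := (- (2 * (a - 1))^-1) \*:
  ((fun s : R => Num.max (a * lambda - s) 0 ^+ 2)
  - (fun s : R => Num.max (lambda - s) 0 ^+ 2)).
have dF : is_derive t 1 F (scad_slope t).
  apply: is_derive_eq; rewrite /scad_slope /GRing.scale /=; by field.
suff <- : F = scad_primitive by [].
apply/funext => s; rewrite /F /scad_primitive /= !fctE /GRing.scale /=.
by rewrite mulNr mulrC -mulNr.
Qed.

Lemma P_SCAD_primitive (t : R) : 0 <= t ->
  P_SCAD a lambda t = scad_primitive t - scad_primitive 0.
Proof.
rewrite le_eqVlt => /predU1P[<-|t0].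
  by rewrite /P_SCAD set_itv1 Rintegral_set1 subrr.
transitivity (\int[@lebesgue_measure R]_(s in `[0, t]) scad_slope s)%R.
  by apply: eq_Rintegral => s _; exact: scad_slopeE.
rewrite /Rintegral (@continuous_FTC2 _ _ scad_primitive)//.
- apply: continuous_subspaceT => s; apply: cvgMl.
  by apply: cvgB; apply: (@continuous_max R R (fun t => _ - t) (fun=> 0));
    [apply: cvgB; [exact: cvg_cst|exact: cvg_id]|exact: cvg_cst|
     apply: cvgB; [exact: cvg_cst|exact: cvg_id]|exact: cvg_cst].
- have cF (s : R) : {for s, continuous scad_primitive}.
    apply: differentiable_continuous; apply/derivable1_diffP.
    by case: (is_derive_scad_primitive s).
  split.
  + by move=> s _; case: (is_derive_scad_primitive s).
  + by apply: cvg_at_right_filter; exact: cF.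
  + by apply: cvg_at_left_filter; exact: cF.
- by move=> s _; rewrite derive1E; case: (is_derive_scad_primitive s).
Qed.

(** The contribution of one coordinate to the quadratic program, divided by
    the sample size, when [h i = t]. *)
Definition scad_dual (g t : R) : R :=
  2^-1 * (a - 1) * g ^+ 2 + g * t - a * lambda * g.

(** Completing the square with [c = a - 1] and [u = a * lambda - t] reduces the
    claim to [max(u, 0) ^ 2 - max(u - c * lambda, 0) ^ 2 >=
    u ^ 2 - (c * g - u) ^ 2] for [0 <= c * g <= c * lambda]. *)
Lemma scad_dual_ge (g t : R) : 0 <= g <= lambda ->
  scad_primitive t <= scad_dual g t.
Proof.
move=> /andP[g0 gl].
have a0 : 0 < 2 * (a - 1) by rewrite mulr_gt0// subr_gt0.
rewrite /scad_primitive ler_pdivrMr// /scad_dual.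
set u := a * lambda - t; set c := a - 1.
have -> : lambda - t = u - c * lambda by rewrite /u /c; ring.
have -> : (2^-1 * c * g ^+ 2 + g * t - a * lambda * g) * (2 * c)
    = (c * g - u) ^+ 2 - u ^+ 2 by rewrite /u /c; field.
have c0 : 0 < c by rewrite subr_gt0.
have cg : 0 <= c * g by rewrite mulr_ge0// ltW.
have cgl : c * g <= c * lambda by rewrite ler_pM2l.
(* The second case, [u <= 0 < u - c * lambda], is contradictory. *)
case: (lerP u 0) => u0; case: (lerP (u - c * lambda) 0) => v0.
- have : 0 <= c * g * (c * g - 2 * u) by rewrite mulr_ge0//; lra.
  lra.
- lra.
- have := sqr_ge0 (c * g - u); lra.
- have : 0 <= (c * lambda - c * g) * (2 * u - c * g - c * lambda).
    by rewrite mulr_ge0//; lra.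
  lra.
Qed.

Lemma scad_dual_slope (t : R) :
  scad_dual (scad_slope t) t = scad_primitive t.
Proof.
have a1 : a - 1 != 0 by rewrite subr_eq0 gt_eqF.
rewrite /scad_dual /scad_primitive /scad_slope.
case: (lerP (a * lambda - t) 0) => ?; case: (lerP (lambda - t) 0) => ?;
  try (field; by []).
(* What is left is [a * lambda <= t < lambda], which is impossible. *)
have : 0 < lambda * (a - 1) by rewrite mulr_gt0// subr_gt0.
lra.
Qed.

Lemma scad_slope_itv (t : R) : 0 <= scad_slope t <= lambda.
Proof.
have a1 : 0 < a - 1 by rewrite subr_gt0.
have al : 0 < lambda * (a - 1) by rewrite mulr_gt0.
rewrite /scad_slope ler_pdivrMr// divr_ge0 ?(ltW a1)//=;
  case: (lerP (a * lambda - t) 0) => ?; case: (lerP (lambda - t) 0) => ?; lra.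
Qed.

End ScadPenalty.

(** * Inner products of columns *)

Section Dot.
Variable (R : realType).

Lemma dotvE (k : nat) (u v : 'cV[R]_k) : dotv u v = \sum_i u i 0 * v i 0.
Proof. by rewrite /dotv mxE; apply: eq_bigr => i _; rewrite mxE. Qed.

Lemma dotvC (k : nat) (u v : 'cV[R]_k) : dotv u v = dotv v u.
Proof. by rewrite !dotvE; apply: eq_bigr => i _; rewrite mulrC. Qed.

Lemma dotvDr (k : nat) (u v w : 'cV[R]_k) :
  dotv u (v + w) = dotv u v + dotv u w.
Proof. by rewrite /dotv mulmxDr mxE. Qed.

Lemma dotvZr (k : nat) (c : R) (u v : 'cV[R]_k) :
  dotv u (c *: v) = c * dotv u v.
Proof. by rewrite /dotv -scalemxAr mxE. Qed.

Lemma dotvNr (k : nat) (u v : 'cV[R]_k) : dotv u (- v) = - dotv u v.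
Proof. by rewrite /dotv mulmxN mxE. Qed.

Lemma dotvDl (k : nat) (u v w : 'cV[R]_k) :
  dotv (v + w) u = dotv v u + dotv w u.
Proof. by rewrite dotvC dotvDr !(dotvC u). Qed.

Lemma dotvZl (k : nat) (c : R) (u v : 'cV[R]_k) :
  dotv (c *: v) u = c * dotv v u.
Proof. by rewrite dotvC dotvZr dotvC. Qed.

Lemma dotvNl (k : nat) (u v : 'cV[R]_k) : dotv (- v) u = - dotv v u.
Proof. by rewrite dotvC dotvNr dotvC. Qed.

Lemma dotv0r (k : nat) (u : 'cV[R]_k) : dotv u 0 = 0.
Proof. by rewrite /dotv mulmx0 mxE. Qed.

Definition dotvB := (dotvDr, dotvDl, dotvNr, dotvNl, dotvZr, dotvZl).

Lemma dotv_mulmx (k l : nat) (M : 'M[R]_(k, l)) (u : 'cV[R]_k) (v : 'cV[R]_l) :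
  dotv u (M *m v) = dotv (M^T *m u) v.
Proof. by rewrite /dotv trmx_mul trmxK mulmxA. Qed.

Lemma dotv_delta (k : nat) (u : 'cV[R]_k) (i : 'I_k) :
  dotv u (delta_mx i 0) = u i 0.
Proof.
rewrite dotvE (bigD1 i)//= mxE !eqxx mulr1 big1 ?addr0// => j /negbTE ji.
by rewrite mxE ji mulr0.
Qed.

Lemma dotv_eq0 (k : nat) (u : 'cV[R]_k) : (forall v, dotv u v = 0) -> u = 0.
Proof.
by move=> u0; apply/matrixP => i j; rewrite (ord1 j) mxE -dotv_delta u0.
Qed.

Lemma complementary_dotv (k : nat) (u v : 'cV[R]_k) :
  complementary u v -> dotv u v = 0.
Proof. by move=> uv; rewrite dotvE big1// => i _; case: (uv i). Qed.

End Dot.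

(** * The quadratic program and its KKT system *)

Section Problems.
Variables (R : realType) (n d m : nat) (a lambda : R).
Variables (Q : 'M[R]_d) (q : 'cV[R]_d) (A : 'M[R]_(d, m)) (b : 'cV[R]_m).

Lemma lpcc_feasible_qp beta g h gamma1 gamma2 gamma3 gamma4 rho :
  lpcc_feasible n a lambda Q q A b
    (LPCCPoint beta g h gamma1 gamma2 gamma3 gamma4 rho) ->
  qp_feasible lambda A b (QPPoint beta g h).
Proof.
move=> [_ [c1 c2 c3 c4 c5]]; split => i.
- by have [_ + _] := c5 i; rewrite !mxE subr_ge0.
- by have [_ + _] := c1 i; rewrite !mxE subr_ge0.
- by have [_ + _] := c2 i; rewrite !mxE; lra.
- by have [_ + _] := c3 i; rewrite mxE.
- by have [_ + _] := c4 i; rewrite !mxE subr_ge0.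
Qed.

(** Pairing stationarity in [beta] with [beta] gives the value of
    [beta^T Q beta]; complementarity turns [(gamma1 - gamma2)^T beta] into
    [(gamma1 + gamma2)^T h], which is [n g^T h] by stationarity in [h], and
    [rho^T A^T beta] into [b^T rho]. Pairing stationarity in [g] with [g] gives
    the [g^T g] term likewise, and the [g^T h] terms cancel. *)
Lemma lpcc_obj_qp beta g h gamma1 gamma2 gamma3 gamma4 rho :
  lpcc_feasible n a lambda Q q A b
    (LPCCPoint beta g h gamma1 gamma2 gamma3 gamma4 rho) ->
  lpcc_obj n a lambda q b
    (LPCCPoint beta g h gamma1 gamma2 gamma3 gamma4 rho)
  = qp_obj n a lambda Q q (QPPoint beta g h).
Proof.
move=> [[e1 e2 e3] [c1 c2 c3 c4 c5]].
have {e1}:= congr1 (dotv beta) e1; have {e2}:= congr1 (dotv h) e2.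
have {e3}:= congr1 (dotv g) e3.
have {c1} := complementary_dotv c1; have {c2} := complementary_dotv c2.
have {c3} := complementary_dotv c3; have {c4} := complementary_dotv c4.
have {c5} := complementary_dotv c5.
rewrite !dotvB !dotv0r /lpcc_obj /qp_obj.
rewrite (dotv_mulmx A beta) (dotvC (A^T *m beta)) (dotvC beta q).
rewrite (dotvC beta gamma1) (dotvC beta gamma2) (dotvC h gamma1).
rewrite (dotvC h gamma2) (dotvC g gamma3) (dotvC g gamma4) (dotvC h g).
rewrite (dotvC g ones) (dotvC b rho) => *.
nra.
Qed.

Local Notation V := ('cV[R]_d * 'cV[R]_d * 'cV[R]_d)%type.
Local Notation I := ('I_m + ('I_d + ('I_d + ('I_d + 'I_d))))%type.

(** A point of the quadratic program is encoded as [v = (beta, g, h)], so that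
    the points form a vector space. *)
Definition qp_constraint (i : I) (v : V) : R :=
  match i with
  | inl j => (A^T *m v.1.1) j 0
  | inr (inl j) => (v.1.1 - v.2) j 0
  | inr (inr (inl j)) => (- v.1.1 - v.2) j 0
  | inr (inr (inr (inl j))) => (- v.1.2) j 0
  | inr (inr (inr (inr j))) => v.1.2 j 0
  end.

Definition qp_bound (i : I) : R :=
  match i with
  | inl j => b j 0
  | inr (inr (inr (inr j))) => lambda
  | _ => 0
  end.

Lemma qp_constraint_scalar i : scalar (qp_constraint i).
Proof.
case: i => [j|[j|[j|[j|j]]]] k u v /=.
- by rewrite mulmxDr -scalemxAr !mxE.
all: by rewrite !mxE; ring.
Qed.

Lemma qp_feasibleE (v : V) :
  qp_feasible lambda A b (QPPoint v.1.1 v.1.2 v.2) <->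
  forall i, qp_constraint i v <= qp_bound i.
Proof.
split=> [[vb bh nbh g0 gl]|vi].
  case=> [j|[j|[j|[j|j]]]] /=.
  - exact: vb.
  - by have := bh j; rewrite !mxE; lra.
  - by have := nbh j; rewrite !mxE; lra.
  - by have := g0 j; rewrite !mxE; lra.
  - by have := gl j; rewrite !mxE; lra.
split=> j.
- exact: (vi (inl j)).
- by have := vi (inr (inl j)); rewrite /= !mxE; lra.
- by have := vi (inr (inr (inl j))); rewrite /= !mxE; lra.
- by have := vi (inr (inr (inr (inl j)))); rewrite /= !mxE; lra.
- by have := vi (inr (inr (inr (inr j)))); rewrite /= !mxE; lra.
Qed.

(** The multipliers are those of [linear_constraints_kkt], sorted by kind of
    constraint; the three stationarity equations are obtained by letting the
    direction vary in one component at a time. *)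
Lemma qp_min_kkt beta g h : Q^T = Q ->
  is_global_min (qp_feasible lambda A b) (qp_obj n a lambda Q q)
    (QPPoint beta g h) ->
  exists gamma1 gamma2 gamma3 gamma4 rho,
  lpcc_feasible n a lambda Q q A b
    (LPCCPoint beta g h gamma1 gamma2 gamma3 gamma4 rho).
Proof.
move=> hQ [feas minz].
pose f (v : V) := qp_obj n a lambda Q q (QPPoint v.1.1 v.1.2 v.2).
pose dg := (n%:R * (a - 1)) *: g + n%:R *: h - (n%:R * a * lambda) *: ones.
pose L (v : V) := dotv (Q *m beta + q) v.1.1 + dotv dg v.1.2
  + dotv (n%:R *: g) v.2.
pose B (v : V) := 2^-1 * (dotv v.1.1 (Q *m v.1.1)
  + n%:R * (a - 1) * dotv v.1.2 v.1.2 + 2 * n%:R * dotv v.1.2 v.2).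
have lL : scalar L by move=> k u v; rewrite /L /= !dotvB; ring.
have fE t v : f (t *: v + (beta, g, h)) = f (beta, g, h) + t * L v + t ^+ 2 * B v.
  rewrite /f /L /B /dg /= mulmxDr -scalemxAr !dotvB.
  rewrite (dotvC v.1.1 (Q *m beta)) (dotvC g v.1.2) (dotvC g v.2).
  rewrite (dotv_mulmx Q beta v.1.1) hQ.
  rewrite (dotvC h v.1.2).
  by field.
have [||y [y0 yc yL]] :=
    @linear_constraints_kkt _ _ _ qp_constraint qp_bound f L B (beta, g, h)
     qp_constraint_scalar lL fE.
- by apply/(qp_feasibleE (beta, g, h)).
- by move=> z /qp_feasibleE; exact: minz.
pose gamma1 : 'cV[R]_d := \col_j y (inr (inl j)).
pose gamma2 : 'cV[R]_d := \col_j y (inr (inr (inl j))).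
pose gamma3 : 'cV[R]_d := \col_j y (inr (inr (inr (inl j)))).
pose gamma4 : 'cV[R]_d := \col_j y (inr (inr (inr (inr j)))).
pose rho : 'cV[R]_m := \col_j y (inl j).
have sumE v : \sum_i y i * qp_constraint i v = dotv rho (A^T *m v.1.1)
    + dotv gamma1 (v.1.1 - v.2) + dotv gamma2 (- v.1.1 - v.2)
    + dotv gamma3 (- v.1.2) + dotv gamma4 v.1.2.
  rewrite !big_sumType /= !addrA !dotvE.
  by congr (_ + _ + _ + _ + _); apply: eq_bigr => j _; rewrite !mxE.
exists gamma1, gamma2, gamma3, gamma4, rho; split.
  split; apply: dotv_eq0 => w.
  - have := yL (w, 0, 0); rewrite sumE /L /= dotv_mulmx trmxK !dotvB !dotv0r.
    lra.
  - have := yL (0, 0, w); rewrite sumE /L /= mulmx0 !dotvB !dotv0r; lra.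
  - have := yL (0, w, 0); rewrite sumE /L /dg /= mulmx0 !dotvB !dotv0r; lra.
have comp k (u s : 'cV[R]_k) (idx : 'I_k -> I) :
    (forall j, u j 0 = y (idx j)) ->
    (forall j, s j 0 = qp_bound (idx j) - qp_constraint (idx j) (beta, g, h)) ->
    complementary u s.
  move=> uE sE j; rewrite uE sE; split => //; rewrite subr_ge0.
  exact: (qp_feasibleE (beta, g, h)).1.
split.
- by apply: (comp _ _ _ (fun j => inr (inl j))) => j; rewrite /= !mxE; ring.
- by apply: (comp _ _ _ (fun j => inr (inr (inl j)))) => j; rewrite /= !mxE; ring.
- by apply: (comp _ _ _ (fun j => inr (inr (inr (inl j))))) => j; rewrite /= !mxE; ring.
- by apply: (comp _ _ _ (fun j => inr (inr (inr (inr j))))) => j; rewrite /= !mxE; ring.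
- by apply: (comp _ _ _ inl) => j; rewrite /= !mxE.
Qed.

Lemma qp_obj_scad_dual beta g h :
  qp_obj n a lambda Q q (QPPoint beta g h)
  = 2^-1 * dotv beta (Q *m beta) + dotv q beta
    + n%:R * \sum_i scad_dual a lambda (g i 0) (h i 0).
Proof.
have -> : \sum_i scad_dual a lambda (g i 0) (h i 0)
    = 2^-1 * (a - 1) * dotv g g + dotv g h - a * lambda * dotv ones g.
  rewrite !dotvE !mulr_sumr -big_split -sumrB /=; apply: eq_bigr => i _.
  by rewrite /scad_dual mxE; ring.
rewrite /qp_obj; by field.
Qed.

Lemma scad_obj_primitive beta : 1 < a -> 0 < lambda ->
  scad_obj n a lambda Q q beta
  = 2^-1 * dotv beta (Q *m beta) + dotv q beta
    + n%:R * \sum_i scad_primitive a lambda `|beta i 0|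
    - n%:R * \sum_(i < d) scad_primitive a lambda 0.
Proof.
move=> a1 l0; rewrite /scad_obj.
rewrite (eq_bigr (fun i => scad_primitive a lambda `|beta i 0|
  - scad_primitive a lambda 0)); first by rewrite sumrB mulrBr addrA.
by move=> i _; exact: P_SCAD_primitive.
Qed.

(** For a feasible [(beta', g, h)], lowering [h] to [|beta'|] and then choosing
    the best [g] does not increase the quadratic objective and leaves the SCAD
    objective of [beta'] plus a constant. At [beta], with [h = |beta|] and [g]
    the slope of the penalty at [|beta|], there is equality throughout. *)
Lemma qp_min_of_scad_min beta : 1 < a -> 0 < lambda ->
  is_global_min (polyhedron A b) (scad_obj n a lambda Q q) beta ->
  is_global_min (qp_feasible lambda A b) (qp_obj n a lambda Q q)
    (QPPoint beta (\col_i scad_slope a lambda `|beta i 0|) (map_mx Num.norm beta)).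
Proof.
move=> a1 l0 [betaL betamin]; split.
  split=> // i; rewrite !mxE.
  - exact: ler_norm.
  - by rewrite -normrN ler_norm.
  - by case/andP: (scad_slope_itv a1 l0 `|beta i 0|).
  - by rewrite mulr1; case/andP: (scad_slope_itv a1 l0 `|beta i 0|).
case=> beta' g h [beta'L bh nbh g0 gl]; rewrite !qp_obj_scad_dual.
rewrite (eq_bigr (fun i => scad_primitive a lambda `|beta i 0|)); last first.
  by move=> i _; rewrite !mxE scad_dual_slope.
have := betamin _ beta'L; rewrite !scad_obj_primitive// lerD2r => /le_trans; apply.
rewrite lerD2l ler_wpM2l ?ler0n// ler_sum// => i _.
have {}g0 : 0 <= g i 0 by have := g0 i; rewrite mxE.
have {}gl : g i 0 <= lambda by have := gl i; rewrite !mxE mulr1.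
have gi : 0 <= g i 0 <= lambda by rewrite g0.
apply: (le_trans (scad_dual_ge a1 _ gi)).
have : `|beta' i 0| <= h i 0.
  by have := bh i; have := nbh i; rewrite mxE ler_norml => *; lra.
by move=> bhi; rewrite /scad_dual lerD2r lerD2l ler_wpM2l.
Qed.
End Problems.

(** * Equivalence *)

Unset Implicit Arguments.
Set Strict Implicit.
Set Printing Implicit Defensive.

Theorem theorem3p2 (R : realType) (n d m : nat)
    (hn : (1 <= n)%N) (hd : (1 <= d)%N) (hm : (m < d)%N)
    (Q : 'M[R]_d) (q : 'cV[R]_d) (A : 'M[R]_(d, m)) (b : 'cV[R]_m)
    (hQ : Q^T = Q) (hA : \rank A = m) (hLambda : polyhedron A b !=set0)
    (a lambda : R) (ha : 1 < a) (hlambda : 0 < lambda)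
    (hSCAD : exists beta : 'cV[R]_d,
       is_global_min (polyhedron A b) (scad_obj n a lambda Q q) beta)
    (beta g h : 'cV[R]_d) :
  is_global_min (qp_feasible lambda A b) (qp_obj n a lambda Q q)
    (QPPoint beta g h)
  <->
  exists (gamma1 gamma2 gamma3 gamma4 : 'cV[R]_d) (rho : 'cV[R]_m),
    is_global_min (lpcc_feasible n a lambda Q q A b)
      (lpcc_obj n a lambda q b)
      (LPCCPoint beta g h gamma1 gamma2 gamma3 gamma4 rho).
Proof.
split=> [qpmin|[gamma1 [gamma2 [gamma3 [gamma4 [rho [feas lpmin]]]]]]].
  have [gamma1 [gamma2 [gamma3 [gamma4 [rho feas]]]]] := qp_min_kkt hQ qpmin.
  exists gamma1, gamma2, gamma3, gamma4, rho; split=> //.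
  case=> beta' g' h' gamma1' gamma2' gamma3' gamma4' rho' feas'.
  rewrite (lpcc_obj_qp feas) (lpcc_obj_qp feas').
  exact/qpmin.2/(lpcc_feasible_qp feas').
(* Compare with the minimizer lifted from the SCAD problem, a KKT point. *)
split=> [|z zfeas]; first exact: lpcc_feasible_qp feas.
have [beta0 /(qp_min_of_scad_min ha hlambda) qpmin0] := hSCAD.
have min0z := qpmin0.2 _ zfeas.
apply: (le_trans _ min0z).
have [gamma1' [gamma2' [gamma3' [gamma4' [rho' feas']]]]] := qp_min_kkt hQ qpmin0.
rewrite -(lpcc_obj_qp feas) -(lpcc_obj_qp feas').
exact: lpmin.
Qed.
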